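(* Let $M$ be a smooth Poisson manifold with Poisson bivector $\pi$, $\mathcal A=C^\infty(M)$ with Poisson bracket $\{\cdot,\cdot\}$, and let $\mathcal C\subseteq\mathcal A$ be a subalgebra with $\{f,g\}=0$ for all $f,g\in\mathcal C$. Let $\ast$ be a star-product on $\mathcal A[[\hbar]]$, $$a\ast b=ab+\hbar B_1(a,b)+\hbar^2B_2(a,b)+\dots,\qquad B_1=\{\cdot,\cdot\}.$$ Then the restriction of $B_2$ to $\mathcal C$ is a Hochschild cocycle, defining a class in $H^2(\mathcal C,\mathcal A)$, also denoted $B_2$. A necessary condition for the existence of a formal automorphism $D=\mathrm{id}+\hbar D_1+\hbar^2D_2+\dots$ of $\mathcal A[[\hbar]]$ such that $$D(a)\ast D(b)=D(ab)\qquad\text{for all }a,b\in\mathcal C$$ is that the class $B_2\in H^2(\mathcal C,\mathcal A)$ lies in the sum of the images of the cup-product $\cup:H^1(\mathcal C,\mathcal A)\otimes H^1(\mathcal C,\mathcal A)\to H^2(\mathcal C,\mathcal A)$ and of the Gerstenhaber action $[\pi,\cdot]:H^1(\mathcal C,\mathcal A)\to H^2(\mathcal C,\mathcal A)$.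
   Context: Local cochains: $CH^n(\mathcal A)$ is the space of $n$-linear maps $\varphi:\mathcal A^{\otimes n}\to\mathcal A$ that are local on $M$: $\varphi(f_1,\dots,f_n)(x)=\varphi(g_1,\dots,g_n)(x)$ whenever $f_i=g_i$ on some open neighbourhood of $x$ for all $i$ (equivalently, $\varphi$ is given by a polydifferential operator on $M$). $CH^n(\mathcal C,\mathcal A)$ is the space of $n$-linear maps $\mathcal C^{\otimes n}\to\mathcal A$ that are local on $M$, meaning that they are restrictions to $\mathcal C$ of elements of $CH^n(\mathcal A)$. Both carry the Hochschild differential $$d\varphi(f_1,\dots,f_{i+1})=f_1\varphi(f_2,\dots,f_{i+1})+\sum_{j=1}^i(-1)^j\varphi(f_1,\dots,f_jf_{j+1},\dots,f_{i+1})+(-1)^{i+1}\varphi(f_1,\dots,f_i)f_{i+1},$$ and $H^*(\mathcal C,\mathcal A)$ denotes the cohomology of $CH^*(\mathcal C,\mathcal A)$. Cup-product: $(\varphi\cup\psi)(f_1,\dots,f_{i+j})=(-1)^{ij}\varphi(f_1,\dots,f_i)\psi(f_{i+1},\dots,f_{i+j})$ for $\varphi$ of degree $i$, $\psi$ of degree $j$. Action of $\pi$: for a 1-cocycle $\xi:\mathcal C\to\mathcal A$ (a derivation of $\mathcal C$ with values in $\mathcal A$), $[\pi,\xi](a,b)=\{\xi(a),b\}+\{a,\xi(b)\}$ for $a,b\in\mathcal C$. This induces the map $[\pi,\cdot]:H^1(\mathcal C,\mathcal A)\to H^2(\mathcal C,\mathcal A)$. (It is the restriction to $\mathcal C$ of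 the Gerstenhaber bracket with the cochain $\pi=\{\cdot,\cdot\}$, which vanishes on $\mathcal C$.) Star-product: an $\hbar$-linear ($\hbar$-adically continuous) associative product on $\mathcal A[[\hbar]]$ of the displayed form with all $B_k\in CH^2(\mathcal A)$; throughout it is assumed that $B_1=\{\cdot,\cdot\}$. Formal automorphism: an $\hbar$-linear automorphism of the space $\mathcal A[[\hbar]]$ of the form $D=\mathrm{id}+\hbar D_1+\hbar^2D_2+\dots$ with all $D_k\in CH^1(\mathcal A)$ (differential operators). *)

(* Defs.v *)
From HB Require Import structures.
From mathcomp Require Import all_boot all_order all_algebra.
From mathcomp Require Import all_classical all_reals all_analysis.
From mathcomp Require Import ring.

Set Implicit Arguments.
Unset Strict Implicit.
Unset Printing Implicit Defensive.
Import Order.TTheory GRing.Theory Num.Theory.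
Import numFieldNormedType.Exports.
Local Open Scope classical_set_scope.
Local Open Scope ring_scope.

Section SmoothOn.
Context {R : realType} {n : nat}.
Implicit Types (U : set 'rV[R]_n) (f g : 'rV[R]_n -> R).

Definition basis_vec (j : 'I_n) : 'rV[R]_n := delta_mx ord0 j.

Definition partial (j : 'I_n) f : 'rV[R]_n -> R := 'D_(basis_vec j) f.

Fixpoint Ck_on (k : nat) U f : Prop :=
  (forall y, U y -> {for y, continuous f}) /\
  if k is k'.+1 then
    forall j, (forall y, U y -> derivable f y (basis_vec j)) /\
              Ck_on k' U (partial j f)
  else True.

Definition smooth_on U f : Prop := forall k, Ck_on k U f.

Lemma near_open U y f g : open U -> U y -> (forall z, U z -> f z = g z) ->
  \near y, f y = g y.
Proof.
move=> oU Uy fg; near=> z; apply: fg.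
by near: z; apply: open_nbhs_nbhs.
Unshelve. all: by end_near. Qed.

Lemma continuous_near y f g : (\near y, f y = g y) ->
  {for y, continuous f} -> {for y, continuous g}.
Proof.
move=> fg cf; have fgy : f y = g y by exact: nbhs_singleton fg.
suff : g @ y --> f y by rewrite fgy.
exact: (cvg_trans (near_eq_cvg fg) cf).
Qed.

Lemma partial_near y j f g : (\near y, f y = g y) -> partial j f y = partial j g y.
Proof. by move=> fg; exact: near_eq_derive. Qed.

Lemma Ck_eq k U f g : open U -> (forall z, U z -> f z = g z) ->
  Ck_on k U f -> Ck_on k U g.
Proof.
move=> oU; elim: k f g => [|k IH] f g fg [cf df]; split => //.
- by move=> y Uy; exact: (continuous_near (near_open oU Uy fg) (cf y Uy)).
- by move=> y Uy; exact: (continuous_near (near_open oU Uy fg) (cf y Uy)).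
- move=> j; have [dfj Cj] := df j; split.
  + move=> y Uy; exact: (near_eq_derivable (near_open oU Uy fg) (dfj y Uy)).
  + apply: IH Cj => z Uz; apply: partial_near; exact: (near_open (U := U)).
Qed.

Lemma CkW k U f : Ck_on k.+1 U f -> Ck_on k U f.
Proof.
elim: k f => [|k IH] f [cf df]; split => // j.
by have [d1 C1] := df j; split => //; exact: IH.
Qed.

Lemma Ck_cst k U (a : R) : open U -> Ck_on k U (cst a).
Proof.
move=> oU; elim: k a => [|k IH] a; split => //; try by move=> y _; exact: cst_continuous.
move=> j; split => [y _|]; first exact: derivable_cst.
by apply: (Ck_eq oU _ (IH 0)) => z _; rewrite /partial derive_cst.
Qed.

Lemma CkD k U f g : open U -> Ck_on k U f -> Ck_on k U g -> Ck_on k U (f \+ g).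
Proof.
move=> oU; elim: k f g => [|k IH] f g [cf df] [cg dg]; split => //.
- by move=> y Uy; apply: continuousD; [exact: cf|exact: cg].
- by move=> y Uy; apply: continuousD; [exact: cf|exact: cg].
- move=> j; have [dfj Cfj] := df j; have [dgj Cgj] := dg j; split.
    by move=> y Uy; apply: derivableD; [exact: dfj|exact: dgj].
  apply: (Ck_eq oU _ (IH _ _ Cfj Cgj)) => z Uz /=.
  by rewrite /partial deriveD //; [exact: dfj|exact: dgj].
Qed.

Lemma CkM k U f g : open U -> Ck_on k U f -> Ck_on k U g -> Ck_on k U (f \* g).
Proof.
move=> oU; elim: k f g => [|k IH] f g Cf Cg.
  case: Cf Cg => [cf _] [cg _]; split => // y Uy.
  by apply: continuousM; [exact: cf|exact: cg].
have Cfk := CkW Cf; have Cgk := CkW Cg.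
case: Cf Cg => [cf df] [cg dg]; split => [y Uy|j].
  by apply: continuousM; [exact: cf|exact: cg].
have [dfj Cfj] := df j; have [dgj Cgj] := dg j; split.
  by move=> y Uy; apply: derivableM; [exact: dfj|exact: dgj].
apply: (Ck_eq oU _ (CkD oU (IH _ _ Cfk Cgj) (IH _ _ Cgk Cfj))) => z Uz /=.
by rewrite /partial deriveM //; [exact: dfj|exact: dgj].
Qed.

Lemma smooth_derivable U f j y : smooth_on U f -> U y ->
  derivable f y (basis_vec j).
Proof. by move=> /(_ 1%N)[_ /(_ j)[df _]] Uy; exact: df. Qed.

End SmoothOn.

(* [fwd] and [bwd] are total functions, meaningful only on [dom] and [cod]. *)
Record chart (R : realType) (n : nat) (M : topologicalType) := Chart {
  dom : set M;
  cod : set 'rV[R]_n;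
  fwd : M -> 'rV[R]_n;
  bwd : 'rV[R]_n -> M;
  dom_open : open dom;
  cod_open : open cod;
  fwd_cod : forall x, dom x -> cod (fwd x);
  bwd_dom : forall y, cod y -> dom (bwd y);
  fwdK : forall x, dom x -> bwd (fwd x) = x;
  bwdK : forall y, cod y -> fwd (bwd y) = y;
  fwd_cont : forall x, dom x -> {for x, continuous fwd};
  bwd_cont : forall y, cod y -> {for y, continuous bwd} }.

Arguments dom_open {R n M} c.
Arguments cod_open {R n M} c.

Definition transition R n M (c c' : chart R n M) (k : 'I_n) :
  'rV[R]_n -> R := fun y => fwd c' (bwd c y) ord0 k.

Definition overlap R n M (c c' : chart R n M) : set 'rV[R]_n :=
  cod c `&` bwd c @^-1` dom c'.

Record manifold (R : realType) (n : nat) := Manifold {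
  carrier :> topologicalType;
  manifold_hausdorff : hausdorff_space carrier;
  manifold_second_countable : @second_countable carrier;
  atlas : set (chart R n carrier);
  atlas_cover : forall x, exists2 c, atlas c & dom c x;
  atlas_smooth : forall c c', atlas c -> atlas c' ->
    forall k, smooth_on (overlap c c') (transition c c' k) }.

Arguments atlas {R n} m.

Section SmoothFunctions.
Context {R : realType} {n : nat} (M : manifold R n).

Definition smooth_fun : {pred (M -> R)} := fun f =>
  `[< forall c, atlas M c -> smooth_on (cod c) (f \o bwd c) >].

Fact smooth_fun_subring : subring_closed smooth_fun.
Proof.
split.
- apply/asboolP => c _ k. exact: (Ck_cst k 1 (cod_open c)).
- move=> f g /asboolP sf /asboolP sg; apply/asboolP => c ac k.
  have Cg : Ck_on k (cod c) (cst (-1) \* (g \o bwd c)).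
    apply: CkM; [exact: cod_open|exact: Ck_cst (cod_open c)|exact: sg].
  apply: (Ck_eq (cod_open c) _ (CkD (cod_open c) (sf c ac k) Cg)) => z _ /=.
  by rewrite mulN1r.
- move=> f g /asboolP sf /asboolP sg; apply/asboolP => c ac k.
  exact: (CkM (cod_open c) (sf c ac k) (sg c ac k)).
Qed.

Fact smooth_fun_scale : subsemimod_closed smooth_fun.
Proof.
have [h1 hB _] := smooth_fun_subring.
have h0 : 0 \in smooth_fun by rewrite -(subrr (1 : M -> R)) hB.
split; first split => //.
- by move=> f g sf sg; rewrite -(opprK g) -(sub0r g); exact: (hB _ _ sf (hB _ _ h0 sg)).
- move=> a f /asboolP sf; apply/asboolP => c ac k.
  exact: (CkM (cod_open c) (Ck_cst k a (cod_open c)) (sf c ac k)).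
Qed.

(* C^oo(M), real-valued *)
Record Cinf := MkCinf { Cinf_val :> M -> R; Cinf_smooth : Cinf_val \in smooth_fun }.

HB.instance Definition _ := [isSub for Cinf_val].
HB.instance Definition _ := [Choice of Cinf by <:].
HB.instance Definition _ :=
  GRing.SubChoice_isSubComPzRing.Build (M -> R) smooth_fun Cinf smooth_fun_subring.
HB.instance Definition _ :=
  GRing.SubZmodule_isSubLmodule.Build R (M -> R) smooth_fun Cinf smooth_fun_scale.

End SmoothFunctions.

(* [bv c i j y] is the component pi^{ij} of the bivector field in the chart [c]
   at the point of coordinates [y]. *)
Record bivector (R : realType) (n : nat) (M : manifold R n) := Bivector {
  bv : chart R n M -> 'I_n -> 'I_n -> 'rV[R]_n -> R;
  bv_smooth : forall c, atlas M c ->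
    forall i j, smooth_on (cod c) (bv c i j);
  bv_anti : forall c, atlas M c ->
    forall i j y, cod c y -> bv c i j y = - bv c j i y;
  bv_change : forall c c', atlas M c -> atlas M c' ->
    forall k l y, overlap c c' y ->
    bv c' k l (fwd c' (bwd c y)) =
      \sum_(i < n) \sum_(j < n)
        bv c i j y * partial i (transition c c' k) y
                   * partial j (transition c c' l) y }.

(* [bracketE] is {f, g} = <pi, df /\ dg> in coordinates; the Jacobi identity is
   the condition [pi, pi] = 0. *)
Record poisson (R : realType) (n : nat) (M : manifold R n) := Poisson {
  poisson_bivector : bivector M;
  bracket : Cinf M -> Cinf M -> Cinf M;
  bracketE : forall c, atlas M c -> forall f g y, cod c y ->
    bracket f g (bwd c y) =
      \sum_(i < n) \sum_(j < n)
        bv poisson_bivector c i j y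
          * partial i (f \o bwd c) y * partial j (g \o bwd c) y;
  jacobi : forall f g h,
    bracket f (bracket g h) + bracket g (bracket h f)
      + bracket h (bracket f g) = 0 }.


Section BracketTheory.
Context {R : realType} {n : nat} {M : manifold R n}.
Local Notation A := (Cinf M).
Implicit Types (f g h : A) (x : M).

Lemma CinfP f g : (forall x, f x = g x) -> f = g.
Proof. by move=> fg; apply: val_inj; apply/funext. Qed.

Lemma CinfD f g x : (f + g) x = f x + g x. Proof. by []. Qed.
Lemma CinfN f x : (- f) x = - f x. Proof. by []. Qed.
Lemma CinfM f g x : (f * g) x = f x * g x. Proof. by []. Qed.
Lemma CinfZ (a : R) f x : (a *: f) x = a * f x. Proof. by []. Qed.

Lemma Cinf_derivable f c j y : atlas M c -> cod c y ->
  derivable (f \o bwd c) y (basis_vec j).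
Proof.
move=> ac cy; have /asboolP sf := Cinf_smooth f.
apply: smooth_derivable cy; exact: sf.
Qed.

Arguments Cinf_derivable f {c} j {y} ac cy.

Variable P : poisson M.

Lemma bracket_linearl h : linear (bracket P ^~ h).
Proof.
move=> a f g; apply: CinfP => x; have [c ac cx] := atlas_cover x.
have cy := fwd_cod cx; rewrite -(fwdK cx) CinfD CinfZ !(bracketE _ ac) //.
rewrite mulr_sumr -big_split; apply: eq_bigr => i _ /=.
rewrite mulr_sumr -big_split; apply: eq_bigr => j _ /=.
have -> : (a *: f + g : A) \o bwd c = (a \*: (f \o bwd c)) \+ (g \o bwd c).
  by apply/funext.
have df := Cinf_derivable f i ac cy; have dg := Cinf_derivable g i ac cy.
rewrite /partial deriveD ?deriveZ //; last exact: derivableZ.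
rewrite mulrDr mulrDl; congr (_ + _).
by rewrite [_ *: _]/GRing.scale /= mulrCA !mulrA.
Qed.

Lemma bracket_anti f g : bracket P f g = - bracket P g f.
Proof.
apply: CinfP => x; have [c ac cx] := atlas_cover x.
have cy := fwd_cod cx; rewrite -(fwdK cx) CinfN !(bracketE _ ac) //.
rewrite exchange_big /= -sumrN; apply: eq_bigr => i _ /=.
rewrite -sumrN; apply: eq_bigr => j _ /=.
by rewrite (bv_anti _ ac) // !mulNr mulrAC.
Qed.

Lemma bracket_linearr h : linear (bracket P h).
Proof.
move=> a f g; rewrite bracket_anti bracket_linearl opprD -scalerN.
by rewrite -!(bracket_anti h).
Qed.

Lemma bracketMl f g h :
  bracket P (f * g) h = f * bracket P g h + g * bracket P f h.
Proof.
apply: CinfP => x; have [c ac cx] := atlas_cover x.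
have cy := fwd_cod cx; rewrite CinfD !CinfM -(fwdK cx) !(bracketE _ ac) //.
rewrite !mulr_sumr -big_split; apply: eq_bigr => i _ /=.
rewrite !mulr_sumr -big_split; apply: eq_bigr => j _ /=.
have -> : (f * g : A) \o bwd c = (f \o bwd c) \* (g \o bwd c).
  by apply/funext.
have df := Cinf_derivable f i ac cy; have dg := Cinf_derivable g i ac cy.
rewrite /partial deriveM // ![_ *: _]/GRing.scale /= mulrDr mulrDl.
by congr (_ + _); rewrite mulrCA !mulrA.
Qed.

Lemma bracketMr f g h :
  bracket P h (f * g) = f * bracket P h g + g * bracket P h f.
Proof. by rewrite bracket_anti bracketMl opprD -!mulrN -!bracket_anti. Qed.

Lemma partial_bwd_near f g c i y : atlas M c -> cod c y ->
  (\forall z \near bwd c y, f z = g z) ->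
  partial i (f \o bwd c) y = partial i (g \o bwd c) y.
Proof.
move=> ac cy fg; apply: partial_near; exact: (bwd_cont cy fg).
Qed.

Lemma bracket_local f f' g g' x :
  (\forall y \near x, f y = f' y) -> (\forall y \near x, g y = g' y) ->
  bracket P f g x = bracket P f' g' x.
Proof.
have [c ac cx] := atlas_cover x; have cy := fwd_cod cx.
rewrite -(fwdK cx) => ff' gg'; rewrite !(bracketE _ ac) //.
apply: eq_bigr => i _; apply: eq_bigr => j _.
by rewrite (partial_bwd_near _ ac cy ff') (partial_bwd_near _ ac cy gg').
Qed.

End BracketTheory.

(* not required to contain the unit *)
Record subalgebra (R : realType) (n : nat) (M : manifold R n) := Subalgebra {
  subalgebra_pred :> {pred Cinf M};
  subalgebra_submod : submod_closed subalgebra_pred;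
  subalgebra_mul : GRing.mulr_2closed subalgebra_pred }.

Section Hochschild.
Context {R : realType} {n : nat} {M : manifold R n}.
Local Notation A := (Cinf M).

Definition tset k (T : Type) (t : k.-tuple T) (i : 'I_k) (a : T) : k.-tuple T :=
  [tuple if j == i then a else tnth t j | j < k].

Definition multilinear k (F : k.-tuple A -> A) : Prop :=
  forall t i, linear (fun a => F (tset t i a)).

Definition local_cochain k (F : k.-tuple A -> A) : Prop :=
  forall (s t : k.-tuple A) (x : M),
    (forall i, \forall y \near x, tnth s i y = tnth t i y) -> F s x = F t x.

(* CH^k(A) *)
Definition CHA k : {pred k.-tuple A -> A} := fun F =>
  `[< multilinear F /\ local_cochain F >].

Arguments CHA k _ : clear implicits.

Variable C : subalgebra M.

Definition sub_of := {f : A | f \in C}.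

Definition sub_mul (f g : sub_of) : sub_of :=
  exist _ (val f * val g) (subalgebra_mul (valP f) (valP g)).

Definition restrict_cochain k (F : k.-tuple A -> A) : k.-tuple sub_of -> A :=
  fun t => F [tuple of map val t].

(* CH^k(C, A) *)
Definition CH k : {pred k.-tuple sub_of -> A} := fun phi =>
  `[< exists2 F, F \in CHA k & phi = restrict_cochain F >].

Arguments CH k _ : clear implicits.

(* (f_0, ..., f_k) |-> (f_0, ..., f_j f_(j+1), ..., f_k) *)
Definition merge_at k (t : k.+1.-tuple sub_of) (j : 'I_k) : k.-tuple sub_of :=
  [tuple if (i < j)%N then tnth t (lift ord_max i)
         else if i == j then sub_mul (tnth t (lift ord_max j)) (tnth t (lift ord0 j))
         else tnth t (lift ord0 i) | i < k].

Definition hoch k (phi : k.-tuple sub_of -> A) : k.+1.-tuple sub_of -> A :=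
  fun t => val (tnth t ord0) * phi [tuple tnth t (lift ord0 i) | i < k]
    + \sum_(j < k) (-1) ^+ j.+1 * phi (merge_at t j)
    + (-1) ^+ k.+1 * phi [tuple tnth t (lift ord_max i) | i < k]
        * val (tnth t ord_max).

Definition cocycle k : {pred k.-tuple sub_of -> A} := fun phi =>
  `[< phi \in CH k /\ hoch phi = 0 >].

Arguments cocycle k _ : clear implicits.

Fact CHA_zmod k : zmod_closed (CHA k).
Proof.
split.
- apply/asboolP; split; last by [].
  by move=> t i a f g; rewrite [LHS]/= [RHS]addr0 scaler0.
- move=> F G /asboolP[mF lF] /asboolP[mG lG]; apply/asboolP; split.
    move=> t i a f g; have := mF t i a f g; have := mG t i a f g => /= mG' mF'.
    have E s : (F - G) s = F s - G s by [].
    by rewrite !E mG' mF' scalerBr opprD addrACA.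
  move=> s t x st; have Fst := lF s t x st; have Gst := lG s t x st.
  by rewrite [LHS]/(F s x - G s x) Fst Gst.
Qed.

Fact CH_zmod k : zmod_closed (CH k).
Proof.
have [h0 hB] := CHA_zmod k; split; first by apply/asboolP; exists 0.
move=> _ _ /asboolP[F hF ->] /asboolP[G hG ->]; apply/asboolP.
by exists (F - G) => //; exact: hB.
Qed.

Lemma hochB k (phi psi : k.-tuple sub_of -> A) :
  hoch (phi - psi) = hoch phi - hoch psi.
Proof.
apply/funext => t; have E (m : nat) (f g : m.-tuple sub_of -> A) s : (f - g) s = f s - g s by [].
rewrite E /hoch !E !(mulrBr, mulrBl).
under eq_bigr do rewrite E mulrBr.
rewrite sumrB [in RHS]opprD [RHS]addrACA; congr (_ + _).
by rewrite opprD addrACA.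
Qed.

Fact cocycle_zmod k : zmod_closed (cocycle k).
Proof.
have [h0 hB] := CH_zmod k; split.
  apply/asboolP; split=> //.
  by rewrite -(subrr (0 : k.-tuple sub_of -> A)) hochB subrr.
move=> phi psi /asboolP[p1 p2] /asboolP[q1 q2]; apply/asboolP.
by rewrite hochB p2 q2 subrr; split => //; exact: hB.
Qed.

(* Z^k(C, A) *)
Record ZH (k : nat) := MkZH {
  Zval :> k.-tuple sub_of -> A;
  Z_cocycle : Zval \in cocycle k }.

HB.instance Definition _ k := [isSub for @Zval k].
HB.instance Definition _ k := [Choice of ZH k by <:].
HB.instance Definition _ k :=
  GRing.SubChoice_isSubZmodule.Build _ (cocycle k) (ZH k) (cocycle_zmod k).

(* there are no cochains in degree -1 *)
Definition is_coboundary (k : nat) : (k.-tuple sub_of -> A) -> Prop :=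
  match k with
  | 0 => fun phi => phi = 0
  | k'.+1 => fun phi => exists2 psi, psi \in CH k' & phi = hoch psi
  end.

(* B^k(C, A) *)
Definition coboundary k : {pred ZH k} := fun z => `[< is_coboundary (Zval z) >].
Arguments coboundary k _ : clear implicits.

Fact coboundary_zmod k : zmod_closed (coboundary k).
Proof.
split.
  apply/asboolP; case: k => //= k; exists 0; first by have [] := CH_zmod k.
  by rewrite -(subrr (0 : k.-tuple sub_of -> A)) hochB subrr.
move=> z w /asboolP bz /asboolP bw; apply/asboolP; move: z w bz bw.
case: k => [|k] [z hz] [w hw] /=; first by move=> -> ->; rewrite subr0.
move=> [f hf ->] [g hg ->]; exists (f - g); last by rewrite hochB.
by have [_] := CH_zmod k; apply.
Qed.

HB.instance Definition _ k :=
  GRing.isZmodClosed.Build (ZH k) (coboundary k) (coboundary_zmod k).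

(* H^k(C, A) *)
Definition HH k : zmodType := Quotient.quot (coboundary k).

Definition hclass k (z : ZH k) : HH k := \pi_(Quotient.quot (coboundary k))%qT z.

Lemma tuple1E (T : Type) (t : 1.-tuple T) : t = [tuple tnth t ord0].
Proof. by apply: eq_from_tnth => i; rewrite (ord1 i). Qed.

Lemma tuple2E (T : Type) (t : 2.-tuple T) : t = [tuple tnth t ord0; tnth t ord_max].
Proof.
by apply: eq_from_tnth => -[[|[|//]] i]; rewrite [RHS](tnth_nth (tnth t ord0)) /=;
  congr tnth; apply: val_inj.
Qed.

Lemma tuple3E (T : Type) (t : 3.-tuple T) :
  t = [tuple tnth t ord0; tnth t (lift ord0 ord0); tnth t ord_max].
Proof.
by apply: eq_from_tnth => -[[|[|[|//]]] i]; rewrite [RHS](tnth_nth (tnth t ord0)) /=;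
  congr tnth; apply: val_inj.
Qed.

Lemma hoch1E (phi : 1.-tuple sub_of -> A) a b :
  hoch phi [tuple a; b] =
    val a * phi [tuple b] - phi [tuple sub_mul a b] + phi [tuple a] * val b.
Proof.
rewrite /hoch big_ord_recl big_ord0 addr0 expr1 sqrrN expr1n mul1r mulN1r.
congr (_ * phi _ - phi _ + phi _ * _);
  by apply: eq_from_tnth => i; rewrite tnth_mktuple (ord1 i).
Qed.

Lemma hoch2E (phi : 2.-tuple sub_of -> A) a b c :
  hoch phi [tuple a; b; c] =
    val a * phi [tuple b; c] - phi [tuple sub_mul a b; c]
      + phi [tuple a; sub_mul b c] - phi [tuple a; b] * val c.
Proof.
rewrite /hoch !big_ord_recl big_ord0 addr0.
rewrite !exprS expr0 !mulr1 !mulN1r opprK mul1r !mulNr addrA.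
rewrite mul1r; congr (_ * phi _ - phi _ + phi _ - phi _ * _);
  by apply: eq_from_tnth => -[[|[|//]] i]; rewrite tnth_mktuple.
Qed.

Lemma CHA1_linear (F : 1.-tuple A -> A) : F \in CHA 1 ->
  linear (fun a => F [tuple a]).
Proof.
move=> /asboolP[mF _] a f g; have := mF [tuple f] ord0 a f g.
have E h : tset [tuple f] ord0 h = [tuple h].
  by apply: eq_from_tnth => i; rewrite tnth_mktuple (ord1 i).
by rewrite !E.
Qed.

Lemma CHA1_local (F : 1.-tuple A -> A) (f g : A) (x : M) : F \in CHA 1 ->
  (\forall y \near x, f y = g y) ->
  \forall y \near x, F [tuple f] y = F [tuple g] y.
Proof.
move=> /asboolP[_ lF] /nbhs_interior fg; near=> y.
apply: lF => i; rewrite (ord1 i) /=; near: y; exact: fg.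
Unshelve. all: by end_near. Qed.

Lemma CHA2_intro (b : A -> A -> A) :
  (forall g, linear (b^~ g)) -> (forall f, linear (b f)) ->
  (forall (f f' g g' : A) (x : M), (\forall y \near x, f y = f' y) ->
    (\forall y \near x, g y = g' y) -> b f g x = b f' g' x) ->
  (fun t : 2.-tuple A => b (tnth t ord0) (tnth t ord_max)) \in CHA 2.
Proof.
move=> bl br bloc; apply/asboolP; split; last first.
  by move=> s t x st; apply: bloc; exact: st.
move=> t [[|[|//]] hi] a f g; rewrite !tnth_mktuple /=; [exact: bl|exact: br].
Qed.

Lemma restrict_cochain2E (b : A -> A -> A) :
  restrict_cochain (fun t : 2.-tuple A => b (tnth t ord0) (tnth t ord_max)) =
  (fun t : 2.-tuple sub_of => b (val (tnth t ord0)) (val (tnth t ord_max))).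
Proof. by apply/funext => t; rewrite /restrict_cochain !tnth_map. Qed.

Lemma CH2_intro (phi : 2.-tuple sub_of -> A) (b : A -> A -> A) :
  (forall g, linear (b^~ g)) -> (forall f, linear (b f)) ->
  (forall (f f' g g' : A) (x : M), (\forall y \near x, f y = f' y) ->
    (\forall y \near x, g y = g' y) -> b f g x = b f' g' x) ->
  (forall f g, phi [tuple f; g] = b (val f) (val g)) -> phi \in CH 2.
Proof.
move=> bl br bloc phiE; apply/asboolP.
exists (fun t : 2.-tuple A => b (tnth t ord0) (tnth t ord_max)).
  exact: CHA2_intro.
by apply/funext => t; rewrite restrict_cochain2E {1}(tuple2E t) phiE.
Qed.

Lemma ZH1_ext (xi : ZH 1) :
  exists2 F, F \in CHA 1 & forall f, xi [tuple f] = F [tuple val f].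
Proof.
have /asboolP[/asboolP[F FC xiF] _] := Z_cocycle xi; exists F => // f.
rewrite xiF /restrict_cochain; congr F; exact: val_inj.
Qed.

Lemma ZH1_derivation (xi : ZH 1) f g :
  xi [tuple sub_mul f g] = val f * xi [tuple g] + xi [tuple f] * val g.
Proof.
have /asboolP[_ xi0] := Z_cocycle xi; have := hoch1E xi f g.
rewrite xi0 => /esym/eqP; rewrite [X in _ == X]/= addrAC subr_eq0 => /eqP.
by move=> ->.
Qed.

Definition cup i j (phi : i.-tuple sub_of -> A) (psi : j.-tuple sub_of -> A) :
    (i + j).-tuple sub_of -> A := fun t =>
  (-1) ^+ (i * j) * phi [tuple tnth t (lshift j p) | p < i]
                  * psi [tuple tnth t (rshift i q) | q < j].

Lemma cup11E (xi eta : 1.-tuple sub_of -> A) f g :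
  cup xi eta [tuple f; g] = - (xi [tuple f] * eta [tuple g]).
Proof.
rewrite /cup expr1 mulN1r mulNr; congr (- (xi _ * eta _));
  by apply: eq_from_tnth => i; rewrite tnth_mktuple (ord1 i).
Qed.

Fact cup_cocycle (xi eta : ZH 1) : cup xi eta \in cocycle 2.
Proof.
have [F FC FE] := ZH1_ext xi; have [G GC GE] := ZH1_ext eta.
apply/asboolP; split.
  apply: (CH2_intro (b := fun f g => - (F [tuple f] * G [tuple g]))).
  - move=> g a f f'; rewrite (CHA1_linear FC) mulrDl opprD scalerN; congr (- _ + _).
    by apply: CinfP => x; rewrite CinfM !CinfZ CinfM mulrA.
  - move=> f a g g'; rewrite (CHA1_linear GC) mulrDr opprD scalerN; congr (- _ + _).
    by apply: CinfP => x; rewrite CinfM !CinfZ CinfM mulrCA.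
  - move=> f f' g g' x ff' gg'; rewrite !CinfN !CinfM.
    by rewrite (nbhs_singleton (CHA1_local FC ff')) (nbhs_singleton (CHA1_local GC gg')).
  - by move=> f g; rewrite cup11E FE GE.
apply/funext => t; rewrite (tuple3E t) hoch2E !cup11E !ZH1_derivation.
set a := tnth _ _; set b := tnth _ _; set c := tnth _ _.
transitivity (0 : A); last by [].
by ring.
Qed.

Definition cupZ (xi eta : ZH 1) : ZH 2 := MkZH (cup_cocycle xi eta).

Lemma coboundary1_eq0 (z : ZH 1) : z \in coboundary 1 -> z = 0.
Proof.
move=> /asboolP /= [psi _ zE]; apply: val_inj; rewrite [LHS]/= zE.
apply/funext => t; rewrite /hoch big_ord0 addr0 expr1 mulN1r mulNr.
have -> : [tuple tnth t (lift ord_max i) | i < 0] =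
          [tuple tnth t (lift ord0 i) | i < 0] by apply: eq_from_tnth => -[].
by rewrite (ord1 ord_max) mulrC subrr.
Qed.

Lemma hclass1_inj : injective (@hclass 1).
Proof.
move=> z w zw; apply/eqP; rewrite -subr_eq0; apply/eqP/coboundary1_eq0.
by rewrite Quotient.idealrBE; apply/eqP.
Qed.

(* Independent of the representatives, see [cupH_class]; likewise for [pi_actH]
   below, see [pi_actH_class]. *)
Definition cupH (x y : HH 1) : HH 2 :=
  hclass (cupZ (repr (x : Quotient.quot (coboundary 1)))
               (repr (y : Quotient.quot (coboundary 1)))).

Lemma repr_hclass (z : ZH 1) :
  repr (hclass z : Quotient.quot (coboundary 1)) = z.
Proof. by apply: hclass1_inj; rewrite /hclass reprK. Qed.

Lemma cupH_class (xi eta : ZH 1) :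
  cupH (hclass xi) (hclass eta) = hclass (cupZ xi eta).
Proof. by rewrite /cupH !repr_hclass. Qed.

(* The image of H^1 (x) H^1 -> H^2: the span of the products of two classes. *)
Definition cup_image : set (HH 2) :=
  [set z | exists (m : nat) (x y : 'I_m -> HH 1), z = \sum_(i < m) cupH (x i) (y i)].

Variable P : poisson M.

Definition poisson_commutative : Prop :=
  {in C &, forall f g, bracket P f g = 0}.

Definition pi_act (xi : 1.-tuple sub_of -> A) : 2.-tuple sub_of -> A := fun t =>
  bracket P (xi [tuple tnth t ord0]) (val (tnth t ord_max))
    + bracket P (val (tnth t ord0)) (xi [tuple tnth t ord_max]).

Hypothesis PC : poisson_commutative.

Fact pi_act_cocycle (xi : ZH 1) : pi_act xi \in cocycle 2.
Proof.
have [F FC FE] := ZH1_ext xi; have lF := CHA1_linear FC.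
have lbl := bracket_linearl P; have lbr := bracket_linearr P.
apply/asboolP; split.
  apply: (CH2_intro (b := fun f g =>
    bracket P (F [tuple f]) g + bracket P f (F [tuple g]))).
  - by move=> g a f f'; rewrite lF !lbl scalerDr addrACA.
  - by move=> f a g g'; rewrite lF !lbr scalerDr addrACA.
  - move=> f f' g g' x ff' gg'; rewrite !CinfD; congr (_ + _);
      apply: bracket_local => //; exact: CHA1_local.
  - by move=> f g; rewrite -!FE.
have E a b : pi_act xi [tuple a; b] =
  bracket P (xi [tuple a]) (val b) + bracket P (val a) (xi [tuple b]) by [].
have lblD f g h : bracket P (f + g) h = bracket P f h + bracket P g h.
  by have := lbl h 1 f g; rewrite !scale1r.
have lbrD f g h : bracket P h (f + g) = bracket P h f + bracket P h g.
  by have := lbr h 1 f g; rewrite !scale1r.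
apply/funext => t; rewrite (tuple3E t) hoch2E !E !ZH1_derivation.
set a := tnth _ _; set b := tnth _ _; set c := tnth _ _.
rewrite /= !lblD !lbrD !bracketMl !bracketMr.
rewrite !(PC (valP a) (valP b)) (PC (valP a) (valP c)) !(PC (valP b) (valP c)).
transitivity (0 : A); last by [].
by ring.
Qed.

Definition pi_actZ (xi : ZH 1) : ZH 2 := MkZH (pi_act_cocycle xi).

Definition pi_actH (x : HH 1) : HH 2 :=
  hclass (pi_actZ (repr (x : Quotient.quot (coboundary 1)))).

Lemma pi_actH_class (xi : ZH 1) : pi_actH (hclass xi) = hclass (pi_actZ xi).
Proof. by rewrite /pi_actH repr_hclass. Qed.

End Hochschild.
Arguments CHA {R n M} k _.
Arguments CH {R n M} C k _.
Arguments cocycle {R n M} C k _.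
Arguments coboundary {R n M} C k _.
Arguments restrict_cochain {R n M} C [k] F _.
Arguments cup_image {R n M} C _.

Section FormalSeries.
Context {R : realType} {n : nat} {M : manifold R n}.
Local Notation A := (Cinf M).

(* A[[hbar]]: the coefficient of hbar^k in u is u k. *)
Definition fps : Type := nat -> A.
Implicit Types (u v : fps) (a b : A).

Definition fconst a : fps := fun k => if k is 0 then a else 0.

(* The action of R[[hbar]] on A[[hbar]]. *)
Definition hscale (c : nat -> R) u : fps :=
  fun k => \sum_(i < k.+1) c i *: u (k - i)%N.

Definition hlinear (L : fps -> fps) : Prop :=
  forall c u v, L (hscale c u + v) = hscale c (L u) + L v.

Definition eq_mod_h (N : nat) u v : Prop := forall k, (k < N)%N -> u k = v k.

Definition hcontinuous (L : fps -> fps) : Prop :=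
  forall u N, exists K, forall u', eq_mod_h K u u' -> eq_mod_h N (L u) (L u').

Definition hcontinuous2 (L : fps -> fps -> fps) : Prop :=
  forall u v N, exists K, forall u' v', eq_mod_h K u u' -> eq_mod_h K v v' ->
    eq_mod_h N (L u v) (L u' v').

Record star_product (P : poisson M) := StarProduct {
  star :> fps -> fps -> fps;
  star_B : nat -> 2.-tuple A -> A;
  star_linearl : forall v, hlinear (star^~ v);
  star_linearr : forall u, hlinear (star u);
  star_continuous : hcontinuous2 star;
  starA : associative star;
  star_B_CHA : forall k, star_B k \in CHA 2;
  starE : forall a b k, star (fconst a) (fconst b) k = star_B k [tuple a; b];
  star_B0 : forall a b, star_B 0 [tuple a; b] = a * b;
  star_B1 : forall a b, star_B 1 [tuple a; b] = bracket P a b }.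

Record formal_automorphism := FormalAutomorphism {
  faut :> fps -> fps;
  faut_D : nat -> 1.-tuple A -> A;
  faut_linear : hlinear faut;
  faut_continuous : hcontinuous faut;
  faut_bij : bijective faut;
  faut_D_CHA : forall k, faut_D k \in CHA 1;
  fautE : forall a k, faut (fconst a) k = faut_D k [tuple a];
  faut_D0 : forall a, faut_D 0 [tuple a] = a }.

End FormalSeries.
Arguments formal_automorphism {R n} M.

(* Main.v *)
Require Import Defs.
From mathcomp Require Import all_boot all_order all_algebra.
From mathcomp Require Import all_classical all_reals all_analysis.
From mathcomp Require Import ring.
Import GRing.Theory.
Local Open Scope classical_set_scope.
Local Open Scope ring_scope.

(** Everything is read off from the coefficients of [hbar] and [hbar^2] in two
    identities of formal series.  An [hbar]-linear map is determined by its
    values on constant series ([hlinear_coef]), so that the product of any two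
    series expands as the triple convolution
    [(u * v)_k = \sum_(i + j + l = k) B_l (u_i, v_j)] ([star_coef]).

    The coefficient of [hbar^2] in [(a * b) * c = a * (b * c)] equates the
    Hochschild differential of [B_2] with a difference of iterated brackets,
    [{{a, b}, c} - {a, {b, c}}], which vanishes for [a], [b], [c] in [C]
    ([restrict_star_B2_cocycle]).

    Now let [D a * D b = D (a b)] on [C].  As the bracket vanishes on [C], the
    coefficient of [hbar] says that [D_1] is a derivation of [C] into [A], that
    is, a 1-cocycle ([restrict_faut_D1_cocycle]).  The coefficient of [hbar^2]
    reads
    [D_2 (a b) = a D_2 b + D_2 a b + D_1 a D_1 b + {D_1 a, b} + {a, D_1 b}
    + B_2 (a, b)], or, since the cup product of 1-cochains carries a sign,
    [B_2 = D_1 \cup D_1 + [pi, - D_1] + d (- D_2)] as cochains on [C]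
    ([star_B2_decomposition]).  In cohomology the last term disappears. *)

Lemma fpsD {R : realType} {n : nat} {M : manifold R n} (u v : @fps R n M) k :
  (u + v : @fps R n M) k = u k + v k.
Proof. by []. Qed.

Lemma fps_split {R : realType} {n : nat} {M : manifold R n} (u : @fps R n M) :
  u = hscale (fun i => (i == 1)%:R) (fun k => u k.+1) + fconst (u 0%N).
Proof.
apply/funext => -[|k]; rewrite fpsD /hscale.
  by rewrite big_ord_recl big_ord0 scale0r !add0r.
rewrite 2!big_ord_recl scale0r scale1r add0r /= subSS subn0 big1 ?addr0 //.
by move=> i _; rewrite scale0r.
Qed.

(** Splitting off the constant term leaves a multiple of [hbar], which an
    [hbar]-linear map shifts by one degree; hence each coefficient of the image
    is reached after finitely many steps. *)
Lemma hlinear_coef {R : realType} {n : nat} {M : manifold R n}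
    {L : @fps R n M -> @fps R n M} : hlinear L ->
  forall k u, L u k = \sum_(i < k.+1) L (fconst (u i)) (k - i)%N.
Proof.
move=> linL; elim=> [|k IHk] u; rewrite {1}(fps_split u) linL.
  rewrite fpsD /hscale !big_ord_recl !big_ord0.
  by rewrite scale0r add0r addr0 add0r.
rewrite fpsD /hscale.
rewrite 2!big_ord_recl scale0r scale1r add0r /= big1 ?addr0; last first.
  by move=> i _; rewrite scale0r.
by rewrite subSS subn0 IHk [RHS]big_ord_recl addrC.
Qed.

Lemma star_coef {R : realType} {n : nat} {M : manifold R n} {P : poisson M}
    (S : star_product P) u v k :
  S u v k = \sum_(i < k.+1) \sum_(j < (k - i).+1)
              star_B S (k - i - j)%N [tuple u i; v j].
Proof.
rewrite (hlinear_coef (star_linearl S v)); apply: eq_bigr => i _.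
rewrite (hlinear_coef (star_linearr S _)); apply: eq_bigr => j _.
exact: starE.
Qed.

Lemma star_coef1 {R : realType} {n : nat} {M : manifold R n} {P : poisson M}
    (S : star_product P) u v :
  S u v 1%N = bracket P (u 0%N) (v 0%N) + u 0%N * v 1%N + u 1%N * v 0%N.
Proof.
by rewrite star_coef !big_ord_recl !big_ord0 /= star_B1 !star_B0 !addr0.
Qed.

Lemma star_coef2 {R : realType} {n : nat} {M : manifold R n} {P : poisson M}
    (S : star_product P) u v :
  S u v 2%N = star_B S 2 [tuple u 0%N; v 0%N]
    + (bracket P (u 0%N) (v 1%N) + bracket P (u 1%N) (v 0%N))
    + (u 0%N * v 2%N + u 1%N * v 1%N + u 2%N * v 0%N).
Proof.
rewrite star_coef !big_ord_recl !big_ord0 /= !star_B1 !star_B0.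
by ring.
Qed.

Lemma bracket0l {R : realType} {n : nat} {M : manifold R n} (P : poisson M) f :
  bracket P 0 f = 0.
Proof. by rewrite -(mulr0 0) bracketMl !mul0r addr0. Qed.

Lemma bracket0r {R : realType} {n : nat} {M : manifold R n} (P : poisson M) f :
  bracket P f 0 = 0.
Proof. by rewrite bracket_anti bracket0l oppr0. Qed.

Lemma restrict_cochain2 {R : realType} {n : nat} {M : manifold R n}
    (C : subalgebra M) F (f g : sub_of C) :
  restrict_cochain C F [tuple f; g] = F [tuple val f; val g].
Proof. by congr F; apply: val_inj. Qed.

Lemma restrict_cochain1 {R : realType} {n : nat} {M : manifold R n}
    (C : subalgebra M) F (f : sub_of C) :
  restrict_cochain C F [tuple f] = F [tuple val f].
Proof. by congr F; apply: val_inj. Qed.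

Lemma restrict_cochain_CH {R : realType} {n : nat} {M : manifold R n}
    (C : subalgebra M) k (F : k.-tuple (Cinf M) -> Cinf M) :
  F \in CHA k -> restrict_cochain C F \in CH C k.
Proof. by move=> FA; apply/asboolP; exists F. Qed.

Lemma restrict_star_B2_cocycle {R : realType} {n : nat} {M : manifold R n}
    {P : poisson M} {C : subalgebra M} (PC : poisson_commutative C P)
    (S : star_product P) :
  restrict_cochain C (star_B S 2) \in cocycle C 2.
Proof.
apply/asboolP; split; first exact/restrict_cochain_CH/star_B_CHA.
apply/funext => t; rewrite (tuple3E t) hoch2E !restrict_cochain2 /=.
set a := tnth t _; set b := tnth t _; set c := tnth t _.
have /= := congr1 (fun u => u 2%N)
  (starA S (fconst (val a)) (fconst (val b)) (fconst (val c))).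
clearbody a b c.
rewrite !star_coef2 !star_coef1 !starE !star_B0 /=.
rewrite (PC _ _ (valP a) (valP b)) (PC _ _ (valP b) (valP c)).
rewrite !(mulr0, mul0r, addr0, bracket0l, bracket0r) => /eqP.
rewrite -subr_eq0 => /eqP assoc.
(* The zero of the goal is the zero function on triples, evaluated at one. *)
transitivity (0 : Cinf M); last by [].
by rewrite -[RHS]assoc; ring.
Qed.

(** The bracket term in degree one is the only obstruction to [D_1] being a
    derivation, and it vanishes on [C]. *)
Lemma restrict_faut_D1_cocycle {R : realType} {n : nat} {M : manifold R n}
    {P : poisson M} {C : subalgebra M} (PC : poisson_commutative C P)
    {S : star_product P} {D : formal_automorphism M} :
  {in C &, forall a b, S (D (fconst a)) (D (fconst b)) = D (fconst (a * b))} ->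
  restrict_cochain C (faut_D D 1) \in cocycle C 1.
Proof.
move=> DM; apply/asboolP; split; first exact/restrict_cochain_CH/faut_D_CHA.
apply/funext => t; rewrite (tuple2E t) hoch1E !restrict_cochain1 /=.
set a := tnth t _; set b := tnth t _.
have /= := congr1 (fun u => u 1%N) (DM _ _ (valP a) (valP b)).
rewrite star_coef1 !fautE !faut_D0 (PC _ _ (valP a) (valP b)) add0r => <-.
transitivity (0 : Cinf M); last by [].
by ring.
Qed.

(** An identity of cochains, before passing to cohomology: the two negated
    arguments come from moving the terms in [D_1] and [D_2] of the second order
    equation to the other side, while the sign of the cup product in bidegree
    [(1, 1)] already absorbs that of [D_1 a D_1 b]. *)
Lemma star_B2_decomposition {R : realType} {n : nat} {M : manifold R n}
    {P : poisson M} {C : subalgebra M}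
    {S : star_product P} {D : formal_automorphism M}
    (D1 := restrict_cochain C (faut_D D 1))
    (D2 := restrict_cochain C (faut_D D 2)) :
  {in C &, forall a b, S (D (fconst a)) (D (fconst b)) = D (fconst (a * b))} ->
  restrict_cochain C (star_B S 2) =
    cup D1 D1 + pi_act P (- D1) + hoch (- D2).
Proof.
move=> DM; apply/funext => t; rewrite (tuple2E t).
set a := tnth t _; set b := tnth t _.
have E (k : nat) (f g : k.-tuple (sub_of C) -> Cinf M) s :
  (f + g) s = f s + g s by [].
have EN (k : nat) (f : k.-tuple (sub_of C) -> Cinf M) s :
  (- f) s = - f s by [].
have brN f g : bracket P (- f) g = - bracket P f g.
  by have := bracket_linearl P g (-1) f 0; rewrite !scaleN1r bracket0l !addr0.
have brNr f g : bracket P f (- g) = - bracket P f g.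
  by rewrite bracket_anti brN -bracket_anti.
rewrite !E cup11E hoch1E /pi_act !EN.
rewrite (_ : [tuple tnth [tuple a; b] ord0] = [tuple a]) //.
rewrite (_ : [tuple tnth [tuple a; b] ord_max] = [tuple b]) //.
rewrite /D1 /D2 restrict_cochain2 !restrict_cochain1 /= brN brNr.
have /= := congr1 (fun u => u 2%N) (DM _ _ (valP a) (valP b)).
rewrite star_coef2 !fautE !faut_D0 => <-.
by ring.
Qed.

Lemma hclass_eq {R : realType} {n : nat} {M : manifold R n}
    {C : subalgebra M} k (z w : ZH C k) :
  z - w \in coboundary C k -> hclass z = hclass w.
Proof. by rewrite Quotient.idealrBE => /eqP. Qed.

Lemma hclassD {R : realType} {n : nat} {M : manifold R n}
    {C : subalgebra M} k (z w : ZH C k) :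
  hclass (z + w) = hclass z + hclass w.
Proof. exact: raddfD. Qed.

Theorem lemma1 (R : realType) (n : nat) (M : manifold R n) (P : poisson M)
    (C : subalgebra M) (PC : poisson_commutative C P) (S : star_product P) :
  exists B2_cocycle : restrict_cochain C (star_B S 2) \in cocycle C 2,
    (exists D : formal_automorphism M,
      forall a b : Cinf M, a \in C -> b \in C ->
        S (D (fconst a)) (D (fconst b)) = D (fconst (a * b))) ->
    [set u + v | u in cup_image C & v in range (pi_actH PC)]
      (hclass (MkZH B2_cocycle)).
Proof.
exists (restrict_star_B2_cocycle PC S) => -[D DM].
pose xi := MkZH (restrict_faut_D1_cocycle PC DM).
exists (cupH (hclass xi) (hclass xi)).
  exists 1%N, (fun=> hclass xi), (fun=> hclass xi).
  by rewrite big_ord_recl big_ord0 addr0.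
exists (pi_actH PC (hclass (- xi))); first by exists (hclass (- xi)).
rewrite cupH_class pi_actH_class -hclassD; apply/esym/hclass_eq/asboolP => /=.
exists (- restrict_cochain C (faut_D D 2)).
  have [CH0 CHB] := CH_zmod C 1; rewrite -sub0r; apply: CHB => //.
  exact/restrict_cochain_CH/faut_D_CHA.
by rewrite (star_B2_decomposition DM) addrAC subrr add0r.
Qed.
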